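(* Let $H$ be a graph and let $G$ be the complement of the line graph of $H$. In every proper coloring $c$ of $G$ (with any number of colors), every vertex $v$ of $G$ has at least $\chi(G)-1$ colors in its closed neighborhood, i.e., $|c(N[v])|\geq \chi(G)-1$.
   Context: Graphs are finite and simple. The complement of the line graph of a graph $H$ is the graph whose vertices are the edges of $H$, two of them being adjacent exactly when they are disjoint as edges of $H$. The closed neighborhood $N[v]$ consists of $v$ and all its neighbors. $\chi$ is the chromatic number. *)

(* Defs.v *)
From mathcomp Require Import all_boot.

Set Implicit Arguments.
Unset Strict Implicit.
Unset Printing Implicit Defensive.

Record sgraph := SGraph {
  vertex :> finType;
  adj : rel vertex;
  adj_sym : symmetric adj;
  adj_irrefl : irreflexive adj }.

Definition edges (G : sgraph) : {set {set G}} :=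
  [set [set p.1; p.2] | p : G * G & adj p.1 p.2].

Definition closed_nbh (G : sgraph) (v : G) : {set G} :=
  [set w | (w == v) || adj v w].

Definition proper_coloring (G : sgraph) (C : eqType) (c : G -> C) : bool :=
  [forall x, forall y, adj x y ==> (c x != c y)].

Definition colorable (G : sgraph) (k : nat) : bool :=
  [exists c : {ffun G -> 'I_k}, proper_coloring c].

Lemma colorable_exists (G : sgraph) : exists k, colorable G k.
Proof.
exists #|G|; apply/existsP; exists [ffun x => enum_rank x].
apply/forallP => x; apply/forallP => y; apply/implyP => xy.
rewrite !ffunE (inj_eq enum_rank_inj); apply/eqP => exy.
by rewrite exy adj_irrefl in xy.
Qed.

Definition chi (G : sgraph) : nat := ex_minn (colorable_exists G).

Section ComplLineGraph.
Variable H : sgraph.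

Definition edge_type : finType := {e : {set H} | e \in edges H}.

Definition disjoint_edges : rel edge_type :=
  fun e f => [disjoint val e & val f].

Lemma disjoint_edges_sym : symmetric disjoint_edges.
Proof. by move=> e f; rewrite /disjoint_edges disjoint_sym. Qed.

Lemma disjoint_edges_irrefl : irreflexive disjoint_edges.
Proof.
case=> e /= eH; apply/negbTE; rewrite /disjoint_edges /=.
case/imsetP: eH => p _ ->; rewrite -setI_eq0 setIid.
by apply/set0Pn; exists p.1; rewrite !inE eqxx.
Qed.

Definition compl_line_graph : sgraph :=
  SGraph disjoint_edges_sym disjoint_edges_irrefl.

End ComplLineGraph.

(* Main.v *)
(** Let [v = ab].  Recolor every edge at [a] with [c v] and every other edge at
    [b] with one new color.  The remaining edges are disjoint from [v], hence
    keep a color of [c(N[v])] other than [c v]; the new coloring is proper and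
    uses at most [|c(N[v])| + 1] colors. *)
Require Import Defs.
From mathcomp Require Import all_boot.

Lemma chi_leq_card_imset (G : sgraph) (T : finType) (f : G -> T) :
  proper_coloring f -> chi G <= #|f @: setT|.
Proof.
move=> /forallP f_proper; rewrite /chi; case: ex_minnP => k _; apply.
have fT x : f x \in f @: setT by rewrite imset_f.
apply/existsP; exists [ffun x => enum_rank_in (fT x) (f x)].
apply/forallP => x; apply/forallP => y; apply/implyP => xy.
have /forallP/(_ y)/implyP/(_ xy) := f_proper x.
apply: contraNneq; rewrite !ffunE => /(congr1 enum_val).
by rewrite !enum_rankK_in // => ->.
Qed.

Lemma edge_typeP (H : sgraph) (v : edge_type H) :
  exists a b, val v = [set a; b].
Proof. by case: v => e /= /imsetP[[a b] _ ->]; exists a, b. Qed.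

Theorem theorem4 (H : sgraph) (C : finType) (c : compl_line_graph H -> C)
    (v : compl_line_graph H) :
  proper_coloring c ->
  chi (compl_line_graph H) - 1 <= #|c @: closed_nbh v|.
Proof.
move=> /forallP c_proper.
have cP x y : disjoint_edges x y -> c x != c y.
  by move=> xy; have /forallP/(_ y)/implyP/(_ xy) := c_proper x.
have [a [b v_ab]] := edge_typeP H v.
have disj_v (x : edge_type H) : a \notin val x -> b \notin val x ->
    disjoint_edges v x.
  move=> ax bx; rewrite /disjoint_edges v_ab disjoint_subset.
  by apply/subsetP => z; rewrite !inE => /orP[] /eqP->.
(* [None] is the new color; edges sharing [a], or sharing [b], are never adjacent. *)
pose f (x : compl_line_graph H) : option C :=
  if a \in val x then Some (c v) else if b \in val x then None else Some (c x).
have f_proper : proper_coloring f.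
  apply/forallP => x; apply/forallP => y; apply/implyP => xy.
  have notin z : z \in val x -> z \notin val y.
    by move=> zx; rewrite (disjointFr (xy : [disjoint val x & val y]) zx).
  rewrite /f; have [ax | ax] := boolP (a \in val x).
    have ay := notin a ax; rewrite (negPf ay).
    (* If [y] avoids [b] as well, it is disjoint from [v], so [c] already separates it from [v]. *)
    by case: ifPn => // b_y; apply: cP; apply: disj_v.
  have [ay | ay] := boolP (a \in val y).
    by case: ifPn => // bx; rewrite eq_sym; apply: cP; apply: disj_v.
  have [bx | bx] := boolP (b \in val x); first by rewrite (negPf (notin b bx)).
  by case: ifPn => // b_y; apply: cP.
rewrite leq_subLR add1n -(card_imset _ (@Some_inj _)).
apply: leq_trans (chi_leq_card_imset _ _ _ f_proper) _.
(* The extra 1 is the color [None], which lies outside the image of [Some]. *)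
have -> : #|Some @: (c @: closed_nbh v)|.+1 =
          #|None |: Some @: (c @: closed_nbh v)|.
  by rewrite cardsU1; case: imsetP => // -[].
apply/subset_leq_card/subsetP => _ /imsetP[x _ ->]; rewrite /f !inE.
(* The color [c v] is counted because [v] lies in its own closed neighborhood. *)
case: ifPn => ax; first by rewrite !imset_f // inE eqxx.
case: ifPn => //= bx; rewrite !imset_f // inE; apply/orP; right.
exact: disj_v.
Qed.
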